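(* For every integer $t\geq 3$ there is a constant $C(t)$, depending only on $t$, such that the following holds. Let $n,m$ be positive integers with $$2m\geq \max \Big\{(t+1)(t+C(t)+2)+3,\ \frac{(t-1)^{2}}{t-2}\big((n-1)(t-1)+2\big)\Big\}.$$ Then $r(F_{m}, F_{t,n})\leq \max\{m,n\}+(t-1)(2m+n)+n+m$.
   Context: For graphs $G,H$, the Ramsey number $r(G,H)$ is the least integer $r$ such that every red/blue edge-coloring of the complete graph $K_r$ contains a red copy of $G$ or a blue copy of $H$. The generalized fan $F_{t,n}$ is $K_1+nK_t$, the join of a single vertex with the disjoint union of $n$ copies of $K_t$; the fan $F_m$ is $F_{2,m}=K_1+mK_2$. *)

(* Defs.v *)
From mathcomp Require Import all_boot all_order all_algebra.

Set Implicit Arguments.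
Unset Strict Implicit.
Unset Printing Implicit Defensive.

Record sgraph := SGraph {
  vertex :> finType;
  adj : rel vertex;
  adj_sym : symmetric adj;
  adj_irr : irreflexive adj }.

Arguments adj {s}.

(* H contains a copy of G as a (not necessarily induced) subgraph. *)
Definition contains (H G : sgraph) : bool :=
  [exists f : {ffun G -> H},
     injectiveb f && [forall x, forall y, adj x y ==> adj (f x) (f y)]].

Section Constructions.

Lemma complete_sym n : symmetric (fun x y : 'I_n => x != y).
Proof. by move=> x y; rewrite eq_sym. Qed.
Lemma complete_irr n : irreflexive (fun x y : 'I_n => x != y).
Proof. by move=> x; rewrite eqxx. Qed.
Definition complete n : sgraph := SGraph (@complete_sym n) (@complete_irr n).

Definition copies_adj n (G : sgraph) (x y : 'I_n * G) : bool :=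
  (x.1 == y.1) && adj x.2 y.2.
Lemma copies_sym n G : symmetric (@copies_adj n G).
Proof. by move=> x y; rewrite /copies_adj eq_sym adj_sym. Qed.
Lemma copies_irr n G : irreflexive (@copies_adj n G).
Proof. by move=> x; rewrite /copies_adj adj_irr andbF. Qed.
Definition copies n (G : sgraph) : sgraph :=
  SGraph (@copies_sym n G) (@copies_irr n G).

Definition join_adj (G H : sgraph) (x y : G + H) : bool :=
  match x, y with
  | inl u, inl v => adj u v
  | inr u, inr v => adj u v
  | _, _ => true
  end.
Lemma join_sym G H : symmetric (@join_adj G H).
Proof. by move=> [x|x] [y|y] //=; rewrite adj_sym. Qed.
Lemma join_irr G H : irreflexive (@join_adj G H).
Proof. by move=> [x|x] /=; rewrite adj_irr. Qed.
Definition join (G H : sgraph) : sgraph :=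
  SGraph (@join_sym G H) (@join_irr G H).

End Constructions.

Definition gfan t n : sgraph := join (complete 1) (copies n (complete t)).

Definition fan m : sgraph := gfan 2 m.

(* An edge-colouring of K_r assigns a colour to every set of vertices; only its
   values on the two-element sets, i.e. the edges of K_r, are ever used. *)
Definition coloring r := {ffun {set 'I_r} -> bool}.

Section ColorClass.
Variables (r : nat) (c : coloring r) (b : bool).

Definition color_adj (x y : 'I_r) : bool := (x != y) && (c [set x; y] == b).
Lemma color_sym : symmetric color_adj.
Proof. by move=> x y; rewrite /color_adj eq_sym setUC. Qed.
Lemma color_irr : irreflexive color_adj.
Proof. by move=> x; rewrite /color_adj eqxx. Qed.
Definition color_class : sgraph := SGraph color_sym color_irr.

End ColorClass.

(* The colour true is red and the colour false is blue. *)
Definition arrows (G H : sgraph) (r : nat) : bool :=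
  [forall c : coloring r,
     contains (color_class c true) G || contains (color_class c false) H].

Section RamseyExists.

Lemma ramsey_clique r (c : coloring r) a b (A : {set 'I_r}) :
  2 ^ (a + b) <= #|A| ->
  (exists2 S : {set 'I_r}, #|S| = a &
     {in S &, forall x y, x != y -> c [set x; y] = true} /\ S \subset A) \/
  (exists2 S : {set 'I_r}, #|S| = b &
     {in S &, forall x y, x != y -> c [set x; y] = false} /\ S \subset A).
Proof.
elim: a b A => [|a IHa] b A.
  by move=> _; left; exists set0; rewrite ?cards0 ?sub0set; split=> // x; rewrite inE.
elim: b A => [|b IHb] A hA.
  by right; exists set0; rewrite ?cards0 ?sub0set; split=> // x; rewrite inE.
have /card_gt0P [x xA] : 0 < #|A| by apply: leq_trans hA; rewrite expn_gt0.
have ext (B S : {set 'I_r}) k (v : bool) : #|S| = k ->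
    B \subset [set y in A :\ x | c [set x; y] == v] ->
    {in S &, forall y z, y != z -> c [set y; z] = v} -> S \subset B ->
    exists2 S' : {set 'I_r}, #|S'| = k.+1 &
     {in S' &, forall y z, y != z -> c [set y; z] = v} /\ S' \subset A.
  move=> hS /subsetP sB cS /subsetP sS.
  have hp y : y \in S -> [/\ y != x, y \in A & c [set x; y] = v].
    by move=> /sS/sB; rewrite !inE => /andP[/andP[-> ->] /eqP ->].
  exists (x |: S).
    rewrite cardsU1 hS; case: (boolP (x \in S)) => // /hp[].
    by rewrite eqxx.
  split; last first.
    by apply/subsetP=> y; rewrite !inE => /orP[/eqP->//|/hp[]].
  move=> y z; rewrite !inE => /orP[/eqP->|yS] /orP[/eqP->|zS] nyz.
  - by rewrite eqxx in nyz.
  - by case: (hp z zS).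
  - by rewrite setUC; case: (hp y yS).
  - exact: cS.
pose B v := [set y in A :\ x | c [set x; y] == v].
have cardB : #|A| = (#|B true| + #|B false|).+1.
  rewrite (cardsD1 x) xA add1n; congr _.+1.
  rewrite -(cardsID [set y | c [set x; y]] (A :\ x)); congr (_ + _).
    by apply: eq_card => y; rewrite !inE eqb_id.
  by apply: eq_card => y; rewrite !inE eqbF_neg andbC.
have [hB|hB] := leqP (2 ^ (a + b.+1)) #|B true|.
  have [[S hS [cS sS]]|[S hS [cS sS]]] := IHa b.+1 (B true) hB.
    by left; apply: (ext (B true) S).
  right; exists S => //; split=> //; apply: (subset_trans sS).
  by apply/subsetP=> y; rewrite !inE -andbA => /and3P[].
have hB' : 2 ^ (a.+1 + b) <= #|B false|.
  rewrite -ltnS -(ltn_add2l (2 ^ (a + b.+1))).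
  have e : a + b.+1 = a.+1 + b by rewrite addnS.
  have := hA; rewrite cardB addnS expnS mul2n -addnn -{1}e => h.
  apply: (leq_ltn_trans h); rewrite addnS ltnS; exact: leq_add hB _.
have [[S hS [cS sS]]|[S hS [cS sS]]] := IHb (B false) hB'.
  left; exists S => //; split=> //; apply: (subset_trans sS).
  by apply/subsetP=> y; rewrite !inE -andbA => /and3P[].
by right; apply: (ext (B false) S).
Qed.

Lemma clique_contains r (c : coloring r) v (G : sgraph) (S : {set 'I_r}) :
  #|S| = #|G| -> {in S &, forall x y, x != y -> c [set x; y] = v} ->
  contains (color_class c v) G.
Proof.
move=> hS cS.
pose f (x : G) : 'I_r := enum_val (cast_ord (esym hS) (enum_rank x)).
have finj : injective f.
  by move=> x y /enum_val_inj/cast_ord_inj/enum_rank_inj.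
apply/existsP; exists [ffun x => f x]; apply/andP; split.
  by apply/injectiveP => x y; rewrite !ffunE => /finj.
apply/forallP=> x; apply/forallP=> y; apply/implyP=> xy; rewrite !ffunE /=.
have nxy : f x != f y.
  by apply: contraTneq xy => /finj->; rewrite adj_irr.
by rewrite /color_adj nxy cS ?eqxx // enum_valP.
Qed.

Lemma ramsey_exists (G H : sgraph) : exists r, arrows G H r.
Proof.
exists (2 ^ (#|G| + #|H|)); apply/forallP=> c.
have hT : 2 ^ (#|G| + #|H|) <= #|[set: 'I_(2 ^ (#|G| + #|H|))]|.
  by rewrite cardsT card_ord.
have [[S hS [cS _]]|[S hS [cS _]]] := ramsey_clique c hT.
- by rewrite (clique_contains hS cS).
- by rewrite (clique_contains hS cS) orbT.
Qed.

End RamseyExists.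

Definition ramsey (G H : sgraph) : nat := ex_minn (ramsey_exists G H).

(* Main.v *)
(** Write M = 2m; since m >= n, the claim is that a colouring of t(M + n) vertices without
    a red F_m and a blue F_{t,n} cannot exist. A red neighbourhood has no red matching of
    size m, so by the Tutte-Berge formula it contains a set S whose removal leaves many red
    components, that is, a large blue clique of representatives. A blue neighbourhood
    becomes blue-K_t-free after deleting fewer than tn vertices, and a blue-K_t-free set of
    about (t-1)M vertices is, up to few vertices, a union of t-1 red cliques of about M
    vertices, the cores.

    Let M + k be the least red degree. Vertices of a core have, outside the K_t-free set, a
    blue clique of red neighbours coming from other components; a weighted double count of
    these red edges shows that k is bounded in terms of t. Then the vertices that are blue
    to almost all cores form a t-th cluster, its size bounds n in terms of t, and every
    vertex is red to almost all of exactly one cluster. If a vertex had n blue neighbours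
    of its own kind, these would extend through the other clusters to a blue F_{t,n}.
    Hence the largest of the t classes, which has at least M + n vertices, is red up to
    blue degree n - 1, and contains a red F_m. *)

Require Import Defs.
From mathcomp Require Import all_boot all_order all_algebra.
From mathcomp Require Import zify.

Set Implicit Arguments.
Unset Strict Implicit.
Unset Printing Implicit Defensive.

Import Order.TTheory GRing.Theory Num.Theory.

(** * Cliques and packings *)

Section Packings.

Variable V : finType.
Implicit Types (r : rel V) (K W : {set V}).

Definition clique r K : bool :=
  [forall x in K, forall y in K, (x != y) ==> r x y].

Lemma cliqueP r K : reflect {in K &, forall x y, x != y -> r x y} (clique r K).
Proof.
apply: (iffP forall_inP) => [h x y xK yK|h x xK].
  by move/implyP: (forall_inP (h x xK) y yK).
by apply/forall_inP=> y yK; apply/implyP; apply: h.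
Qed.

Lemma sub_clique r K W : K \subset W -> clique r W -> clique r K.
Proof.
by move=> /subsetP s /cliqueP h; apply/cliqueP=> x y /s xW /s yW; apply: h.
Qed.

Definition clique_in r t W K : bool := [&& K \subset W, #|K| == t & clique r K].

Lemma clique_in_sub r t W W' K :
  W \subset W' -> clique_in r t W K -> clique_in r t W' K.
Proof.
by move=> s /and3P[sK cK kK]; apply/and3P; split=> //; apply: subset_trans s.
Qed.

Definition clique_free r t W : bool := [forall K, ~~ clique_in r t W K].

Lemma subset_of_card (A : {set V}) k :
  k <= #|A| -> exists2 B : {set V}, B \subset A & #|B| = k.
Proof.
elim: k => [|k IHk] hk; first by exists set0; rewrite ?sub0set ?cards0.
have [B sB cB] := IHk (ltnW hk).
have /subsetPn[x xA xB] : ~~ (A \subset B).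
  by apply: contraL hk => /subset_leq_card; rewrite cB -leqNgt.
exists (x |: B); first by rewrite subUset sub1set xA.
by rewrite cardsU1 xB cB.
Qed.

Lemma card_cover_le (I : finType) (J : {set I}) (F : I -> {set V}) (U : {set V}) b :
  {in U, forall x, exists2 i, i \in J & x \in F i} -> {in J, forall i, #|F i| <= b} ->
  #|U| <= #|J| * b.
Proof.
move=> hU hF; apply: (@leq_trans (\sum_(x in U) \sum_(i in J) (x \in F i))).
  rewrite -sum1_card; apply: leq_sum => x /hU[i iJ xi].
  by rewrite (bigD1 i) //= xi.
rewrite exchange_big -sum_nat_const /=; apply: leq_sum => i /hF; apply: leq_trans.
rewrite -sum1_card [leqLHS]big_mkcond [leqRHS]big_mkcond; apply: leq_sum => x _.
by case: (x \in U); case: (x \in F i).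
Qed.

Lemma clique_free_card r t W K :
  clique_free r t W -> K \subset W -> clique r K -> #|K| < t.
Proof.
move=> /forallP h sK cK; rewrite ltnNge; apply/negP=> /subset_of_card[B sB cB].
have := h B; rewrite /clique_in cB eqxx (subset_trans sB sK).
by rewrite (sub_clique sB cK).
Qed.

Lemma cliqueU1 r x K :
  symmetric r -> {in K, forall y, r x y} -> clique r K -> clique r (x |: K).
Proof.
move=> rs h /cliqueP cK; apply/cliqueP=> y z.
rewrite !inE => /orP[/eqP->|yK] /orP[/eqP->|zK] nyz.
- by rewrite eqxx in nyz.
- exact: h.
- by rewrite rs; apply: h.
- exact: cK.
Qed.

Fixpoint packing r t n W : Prop :=
  if n is n'.+1 then exists2 K, clique_in r t W K & packing r t n' (W :\: K)
  else True.

Lemma packing_sub r t n W W' : W \subset W' -> packing r t n W -> packing r t n W'.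
Proof.
elim: n W W' => //= n IHn W W' s [K cK pK]; exists K; first exact: clique_in_sub cK.
by apply: IHn pK; apply: setSD.
Qed.

Lemma eq_packing r r' t n W : r =2 r' -> packing r t n W -> packing r' t n W.
Proof.
move=> err; elim: n W => //= n IHn W [K /and3P[sK cK /cliqueP kK] pK].
exists K; last exact: IHn.
rewrite /clique_in sK cK; apply/cliqueP=> x y xK yK nxy.
by rewrite -err; apply: kK.
Qed.

(** Greedy deletion stops after at most n - 1 cliques, and T is their union. *)
Lemma packing_hitting r t n W : ~ packing r t n W ->
  exists T : {set V}, [/\ T \subset W, #|T| + t <= t * n & clique_free r t (W :\: T)].
Proof.
elim: n W => [|n IHn] W /= np; first by case: np.
case: (boolP (clique_free r t W)) => [cf|].
  exists set0; rewrite sub0set cards0 setD0; split=> //.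
  by rewrite mulnS leq_addr.
rewrite negb_forall => /existsP[K]; rewrite negbK => cK.
have [|T [sT cT fT]] := IHn (W :\: K); first by move=> p; apply: np; exists K.
have /and3P[sK /eqP eK _] := cK.
exists (K :|: T); split.
- by rewrite subUset sK (subset_trans sT) // subsetDl.
- rewrite mulnS; apply: leq_trans (_ : #|K| + #|T| + t <= _).
    by rewrite leq_add2r cardsU leq_subr.
  by rewrite eK -addnA leq_add2l.
- by rewrite -setDDl.
Qed.

Lemma packing_family r t n W : packing r t n W ->
  exists F : nat -> {set V},
    (forall i, i < n -> clique_in r t W (F i)) /\
    (forall i j x, i < n -> j < n -> x \in F i -> x \in F j -> i = j).
Proof.
elim: n W => [|n IHn] W /=; first by move=> _; exists (fun=> set0).
move=> [K cK /IHn[F [cF dF]]].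
exists (fun i => if i is i'.+1 then F i' else K); split.
  by case=> // i; rewrite ltnS => /cF; apply: clique_in_sub; apply: subsetDl.
have nK i x : i < n -> x \in F i -> x \notin K.
  move=> /cF/and3P[/subsetP s _ _] /s; rewrite inE => /andP[] //.
case=> [|i] [|j] x //= hi hj xi xj.
- by rewrite (negPf (nK _ _ hj xj)) in xi.
- by rewrite (negPf (nK _ _ hi xi)) in xj.
- by congr _.+1; apply: dF xi xj.
Qed.

Lemma clique_packing r t n K : clique r K -> t * n <= #|K| -> packing r t n K.
Proof.
elim: n K => //= n IHn K cK; rewrite mulnS => h.
have [B sB cB] := subset_of_card (leq_trans (leq_addr _ _) h).
exists B; first by rewrite /clique_in sB cB eqxx (sub_clique sB).
apply: IHn; first by apply: sub_clique cK; apply: subsetDl.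
by rewrite cardsD (setIidPr sB) cB; lia.
Qed.

(* Each clique of the packing takes one vertex of A and t vertices of K. *)
Lemma clique_join_packing r t n K (A : {set V}) : symmetric r -> clique r K ->
  {in K & A, forall x y, r x y} -> [disjoint K & A] ->
  t * n <= #|K| -> n <= #|A| -> packing r t.+1 n (K :|: A).
Proof.
move=> rs; elim: n K A => //= n IHn K A cK KA dKA; rewrite mulnS => hK hA.
have [B sB cB] := subset_of_card (leq_trans (leq_addr _ _) hK).
have /card_gt0P[a aA] : 0 < #|A| by apply: leq_ltn_trans hA.
have aK : a \notin K by apply: contraL aA => /(disjointFr dKA)->.
exists (a |: B).
  apply/and3P; split.
  - rewrite subUset sub1set inE aA orbT /= subsetU //.
    by rewrite sB.
  - by rewrite cardsU1 cB (contra (subsetP sB a)).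
  - apply: cliqueU1 => //; last exact: sub_clique cK.
    by move=> y /(subsetP sB) yK; rewrite rs; apply: KA.
apply: (@packing_sub _ _ _ ((K :\: B) :|: (A :\ a))).
  apply/subsetP=> x; rewrite !inE => /orP[/andP[nB xK]|/andP[na xA]].
    by rewrite xK (negPf nB) orbF /= andbT; apply: contraNneq aK => <-.
  rewrite xA orbT andbT negb_or na; apply/negP=> /(subsetP sB) xK.
  by rewrite (disjointFr dKA xK) in xA.
apply: IHn.
- by apply: sub_clique cK; apply: subsetDl.
- by move=> x y; rewrite !inE => /andP[_ xK] /andP[_ yA]; apply: KA.
- by apply: disjointWl (subsetDl _ _) _; apply: disjointWr dKA; apply: subsetDl.
- by rewrite cardsD (setIidPr sB) cB; lia.
- by have := cardsD1 a A; rewrite aA; lia.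
Qed.

End Packings.

Lemma packing_gfan (G : sgraph) t n (x : G) :
  packing (@adj G) t n [set y | adj x y] -> contains G (gfan t n).
Proof.
move=> /packing_family[F [cF dF]].
(* The default [x] of [nth] is never returned: each [F i] with i < n has exactly t elements. *)
pose f (z : gfan t n) : G :=
  match z with inl _ => x | inr p => nth x (enum (F p.1)) p.2 end.
have fin (p : 'I_n * 'I_t) : nth x (enum (F p.1)) p.2 \in F p.1.
  have /and3P[_ /eqP c _] := cF _ (ltn_ord p.1).
  by rewrite -mem_enum mem_nth // -cardE c.
have fx (p : 'I_n * 'I_t) : adj x (nth x (enum (F p.1)) p.2).
  have /and3P[/subsetP s _ _] := cF _ (ltn_ord p.1).
  by have := s _ (fin p); rewrite inE.
have finj : injective f.
  move=> [a|p] [b|q] //=.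
  - by rewrite (ord1 a) (ord1 b).
  - by move=> h; have := fx q; rewrite -h adj_irr.
  - by move=> h; have := fx p; rewrite h adj_irr.
  move=> h; have h1 : p.1 = q.1.
    apply: val_inj; apply: (dF _ _ _ (ltn_ord _) (ltn_ord _) (fin p)).
    by have := fin q; rewrite -h.
  congr inr; case: p q h h1 => [p1 p2] [q1 q2] /= h h1.
  rewrite -{}h1 in h *; congr pair; apply: val_inj; apply/eqP.
  have /and3P[_ /eqP c _] := cF _ (ltn_ord p1).
  have sz : size (enum (F p1)) = t by rewrite -cardE.
  by rewrite -(nth_uniq x _ _ (enum_uniq (F p1))) ?sz ?ltn_ord // h.
apply/existsP; exists [ffun z => f z]; apply/andP; split.
  by apply/injectiveP=> a b; rewrite !ffunE => /finj.
apply/forallP=> a; apply/forallP=> b; apply/implyP=> ab; rewrite !ffunE.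
have nab : f a != f b by apply: contraTneq ab => /finj ->; rewrite adj_irr.
case: a b ab nab => [a|[p1 p2]] [b|[q1 q2]] //=.
- by rewrite (ord1 a) (ord1 b) eqxx.
- by move=> _ _; apply: (fx (q1, q2)).
- by move=> _ _; rewrite adj_sym; apply: (fx (p1, p2)).
move=> /andP[/= /eqP <- _]; have /and3P[_ _ /cliqueP h] := cF _ (ltn_ord p1).
by move=> /h; apply; [apply: (fin (p1, p2))|apply: (fin (p1, q2))].
Qed.

(** * Matchings *)

Section Matchings.

Variables (V : finType) (e : rel V).
Hypothesis e_sym : symmetric e.
Implicit Types (A B : {set V}) (f g : {ffun V -> V}).

(* A matching is encoded as an involution whose fixed points are the unmatched vertices. *)
Definition matching A f : bool :=
  [forall x, (f (f x) == x) && ((f x != x) ==> (x \in A) && e x (f x))].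

Definition moved f := [set x | f x != x].
Definition missed A f := [set x in A | f x == x].

Lemma matchingK A f : matching A f -> involutive f.
Proof. by move=> /forallP h x; case/andP: (h x) => /eqP. Qed.

Lemma matchingE A f x : matching A f -> f x != x -> x \in A /\ e x (f x).
Proof. by move=> /forallP h nx; case/andP: (h x) => _ /implyP/(_ nx)/andP. Qed.

Lemma matchingP A f : involutive f -> (forall x, f x != x -> x \in A /\ e x (f x)) ->
  matching A f.
Proof.
move=> fK h; apply/forallP=> x; rewrite fK eqxx; apply/implyP=> /h[-> ->] //.
Qed.

Lemma matching_sub A B f : A \subset B -> matching A f -> matching B f.
Proof.
move=> /subsetP s mf; apply: matchingP; first exact: matchingK mf.
by move=> x /(matchingE mf)[/s].
Qed.

Lemma card_missed A f : matching A f -> #|missed A f| + #|moved f| = #|A|.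
Proof.
move=> mf; rewrite -[RHS](cardsID [set x | f x == x]); congr (_ + _).
  by apply: eq_card => x; rewrite !inE.
apply: eq_card => x; rewrite !inE; case: (boolP (f x == x)) => //= nx.
by have [->] := matchingE mf nx.
Qed.

Definition unmatch f x : {ffun V -> V} :=
  [ffun y => if (y == x) || (y == f x) then y else f y].

Lemma unmatchP A f x : matching A f -> f x != x ->
  matching (A :\: [set x; f x]) (unmatch f x) /\ #|moved f| = #|moved (unmatch f x)| + 2.
Proof.
move=> mf nx; have fK := matchingK mf.
have uE y : unmatch f x y = if (y == x) || (y == f x) then y else f y by rewrite ffunE.
have cl y : (f y == x) || (f y == f x) = (y == x) || (y == f x).
  by rewrite (inj_eq (inv_inj fK)) orbC (inv_eq fK).
split.
  apply: matchingP => [y|y].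
    rewrite [unmatch f x y]uE; case: ifP => h; rewrite uE ?h //.
    by rewrite cl h fK.
  rewrite uE; case: ifP => [_|h]; first by rewrite eqxx.
  by move=> /(matchingE mf)[yA ey]; rewrite !inE h yA.
rewrite -(cardsID [set x; f x] (moved f)) addnC; congr (_ + _).
  by apply: eq_card => y; rewrite !inE uE; case: ifP => h; rewrite ?eqxx.
rewrite (_ : _ :&: _ = [set x; f x]) ?cards2 1?eq_sym ?nx //.
by apply/setIidPr/subsetP=> y; rewrite !inE => /orP[]/eqP->; rewrite ?fK // eq_sym.
Qed.

Lemma card_moved_even A f : matching A f -> ~~ odd #|moved f|.
Proof.
move: {2}#|moved f| (leqnn #|moved f|) => k; elim: k A f => [|k IHk] A f hk mf.
  by move: hk; rewrite leqn0 => /eqP->.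
case: (set_0Vmem (moved f)) => [->|[x]]; first by rewrite cards0.
rewrite inE => nx; have [mu cu] := unmatchP mf nx.
by rewrite cu oddD addbF (IHk _ _ _ mu) //; lia.
Qed.

(** A matching moves an even number of vertices, so the successor on the right is free; it yields
    the constant 2 in [red_labels]. *)
Lemma matching_packing A f m : matching A f -> 2 * m <= (#|moved f|).+1 -> packing e 2 m A.
Proof.
elim: m A f => //= m IHm A f mf hm.
have /card_gt0P[x] : 0 < #|moved f| by lia.
rewrite inE => nx; have [mu cu] := unmatchP mf nx.
exists [set x; f x]; last by apply: IHm mu _; lia.
have [xA ex] := matchingE mf nx.
have [fxA _] : f x \in A /\ e (f x) (f (f x)).
  by apply: (matchingE mf); rewrite (matchingK mf) eq_sym.
apply/and3P; split.
- by rewrite subUset !sub1set xA fxA.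
- by rewrite cards2 [x == _]eq_sym nx.
- apply/cliqueP=> y z; rewrite !inE => /orP[]/eqP-> /orP[]/eqP->; rewrite ?eqxx //.
  by rewrite e_sym.
Qed.

Definition max_matching A f : bool :=
  matching A f && [forall g, matching A g ==> (#|missed A f| <= #|missed A g|)].

Lemma max_matchingP A f : reflect
  (matching A f /\ forall g, matching A g -> #|missed A f| <= #|missed A g|)
  (max_matching A f).
Proof.
apply: (iffP andP) => [[-> /forallP h]|[-> h]]; split=> //.
  by move=> g; apply/implyP.
by apply/forallP=> g; apply/implyP; apply: h.
Qed.

Lemma max_matching_exists A : exists f, max_matching A f.
Proof.
have m0 : matching A [ffun x => x].
  by apply: matchingP => [x|x]; rewrite !ffunE // eqxx.
case: (arg_minnP (fun f => #|missed A f|) m0) => f mf h.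
by exists f; apply/max_matchingP.
Qed.

Lemma iter_fixM (h : V -> V) v c k : iter c h v = v -> iter (k * c) h v = v.
Proof. by move=> hc; elim: k => // k IHk; rewrite mulSn iterD IHk. Qed.

(* Gallai's lemma: the relation "no maximum matching misses both" is transitive. *)
Lemma gallai_transitive A f g u v w : max_matching A f -> max_matching A g ->
  f u = u -> f w = w -> u != w -> g v = v ->
  exists2 f', max_matching A f' & f' v = v /\ (f' u = u \/ f' w = w).
Proof.
move=> /max_matchingP[mf minf] /max_matchingP[mg ming] fu fw nuw gv.
have fK := matchingK mf; have gK := matchingK mg.
pose h x := g (f x); pose h' x := f (g x).
have hinj : injective h by move=> x y /(inv_inj gK)/(inv_inj fK).
have h'K x : h (h' x) = x by rewrite /h /h' fK gK.
have ih'K i x : iter i h (iter i h' x) = x.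
  by elim: i x => // i IHi x; rewrite iterSr iterS h'K IHi.
have gi i : g (iter i h v) = iter i h' v.
  by elim: i => //= i IHi; rewrite -IHi {1}/h gK /h' gK.
(* P is the component of v in the union of f and g; since g fixes v, it reverses the orbit. *)
pose P := [set x | fconnect h v x].
have Pg x : x \in P -> g x \in P.
  rewrite !inE => /iter_findex <-; rewrite gi fconnect_sym //.
  by have := fconnect_iter h (findex h v x) (iter (findex h v x) h' v); rewrite ih'K.
have Pf x : x \in P -> f x \in P.
  move=> xP; rewrite -[f x]gK; apply: Pg; move: xP; rewrite !inE => xP.
  by apply: connect_trans xP (fconnect1 h x).
(* P is a path from v, and an f-fixed point on it is its other end. Two such points at positions i
   and j give v the periods 2i + 1 and 2j + 1, hence j - i, so they coincide and P omits u or w. *)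
have odd_fix i : f (iter i h v) = iter i h v -> iter (i.*2.+1) h v = v.
  move=> fi; rewrite -addnn -addSn iterD -fi -[f _]gK -[g (f _)]/(h _) -iterS gi.
  exact: ih'K.
have vP : v \in P by rewrite inE connect0.
have uniq i j : i <= j -> f (iter i h v) = iter i h v -> f (iter j h v) = iter j h v ->
    iter i h v = iter j h v.
  move=> lij /odd_fix ci /odd_fix cj.
  have c2 : iter ((j - i) * 2) h v = v.
    rewrite -{1}ci -iterD (_ : _ + _ = j.*2.+1) //; lia.
  have := iter_fixM (j - i) ci.
  rewrite (_ : (j - i) * i.*2.+1 = (j - i) + i * ((j - i) * 2)); last by lia.
  rewrite iterD (iter_fixM i c2) => c1.
  by rewrite -(subnKC lij) iterD c1.
have nP : (u \notin P) || (w \notin P).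
  rewrite -negb_and; apply: contra nuw => /andP[]; rewrite !inE.
  move=> /iter_findex eu /iter_findex ew; rewrite -eu -ew in fu fw *.
  by case/orP: (leq_total (findex h v u) (findex h v w)) => l;
    rewrite (uniq _ _ l).
(* After the switch on P, f' and g' together miss as many vertices as f and g, so f' is again
   maximum. *)
pose f' := [ffun x => if x \in P then g x else f x].
pose g' := [ffun x => if x \in P then f x else g x].
have gP x : (g x \in P) = (x \in P).
  by apply/idP/idP => [/Pg|/Pg //]; rewrite gK.
have fP x : (f x \in P) = (x \in P).
  by apply/idP/idP => [/Pf|/Pf //]; rewrite fK.
have mf' : matching A f'.
  apply: matchingP => x; rewrite !ffunE.
    by case: (x \in P) (gP x) (fP x) => hg hf; rewrite ?hg ?hf ?gK ?fK.
  by case: ifP => _; [apply: matchingE|apply: matchingE].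
have mg' : matching A g'.
  apply: matchingP => x; rewrite !ffunE.
    by case: (x \in P) (gP x) (fP x) => hg hf; rewrite ?hg ?hf ?gK ?fK.
  by case: ifP => _; [apply: matchingE|apply: matchingE].
have spl f0 : #|missed A f0| = #|missed A f0 :&: P| + #|missed A f0 :\: P|.
  by rewrite cardsID.
have i1 : missed A f' :&: P = missed A g :&: P.
  by apply/setP=> x; rewrite !inE !ffunE inE; case: ifP; rewrite ?andbF.
have i2 : missed A f' :\: P = missed A f :\: P.
  by apply/setP=> x; rewrite !inE !ffunE inE; case: ifP.
have i3 : missed A g' :&: P = missed A f :&: P.
  by apply/setP=> x; rewrite !inE !ffunE inE; case: ifP; rewrite ?andbF.
have i4 : missed A g' :\: P = missed A g :\: P.
  by apply/setP=> x; rewrite !inE !ffunE inE; case: ifP.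
exists f'.
  apply/max_matchingP; split=> // k mk; apply: leq_trans (minf k mk).
  have := ming g' mg'; rewrite (spl f') (spl f) (spl g) (spl g') i1 i2 i3 i4.
  by rewrite leq_add2r => ?; rewrite leq_add2r.
rewrite !ffunE vP; split=> //.
by case/orP: nP => /negPf->; [left|right].
Qed.

(* The Tutte-Berge formula without parities: instead of odd components of A - S it counts
   the values of a labelling which is constant on every component. *)
Theorem tutte_berge A : exists f (S : {set V}) (l : V -> {set V}),
  [/\ matching A f, S \subset A,
      {in A :\: S &, forall x y, e x y -> l x = l y} &
      #|missed A f| + #|S| <= #|l @: (A :\: S)|].
Proof.
move: {2}#|A| (erefl #|A|) => k; elim: k A => [|k IHk] A cA.
  have [f /max_matchingP[mf _]] := max_matching_exists A.
  have A0 : A = set0 by apply/eqP; rewrite -cards_eq0 cA.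
  exists f, set0, (fun=> set0); split=> //; first exact: sub0set.
  rewrite cards0 addn0 A0; apply: leq_trans (leq0n _).
  by rewrite leqn0 cards_eq0; apply/eqP/setP=> x; rewrite !inE.
(* If every maximum matching covers a, then a joins the S obtained by induction from [A :\ a];
   otherwise S is empty. *)
case: (boolP [exists a in A, forall f, max_matching A f ==> (f a != a)]).
  move=> /exists_inP[a aA /forallP ha].
  have cAa : #|A :\ a| = k by move: cA; rewrite (cardsD1 a) aA => -[].
  have [f [S [l [mf sS el cl]]]] := IHk _ cAa.
  have mf' : matching A f by apply: matching_sub mf; apply: subsetDl.
  have [g0 mg0] := max_matching_exists A; have /max_matchingP[mg ming] := mg0.
  have fa : f a = a.
    by apply/eqP; apply: contraT => /(matchingE mf)[]; rewrite !inE eqxx.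
  have lt : #|missed A g0| < #|missed A f|.
    rewrite ltn_neqAle ming // andbT; apply/negP=> /eqP eq.
    suff mm : max_matching A f by have := ha f; rewrite mm fa eqxx.
    by apply/max_matchingP; split=> // g; rewrite -eq; apply: ming.
  (* By parity the strict inequality gains two: one unit accounts for a, which f misses in A, the
     other for a joining S. *)
  have := card_moved_even mf; have := card_moved_even mg.
  have := card_missed mf; have := card_missed mf'; have := card_missed mg.
  rewrite cAa cA => h1 h2 h3 p1 p2.
  have aS : a \notin S by apply/negP=> /(subsetP sS); rewrite !inE eqxx.
  have eD : A :\: (a |: S) = (A :\ a) :\: S by rewrite setDDl.
  exists g0, (a |: S), l; split=> //.
  - by rewrite subUset sub1set aA (subset_trans sS) // subsetDl.
  - by rewrite eD.
  - rewrite eD cardsU1 aS; apply: leq_trans cl; lia.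
rewrite negb_exists_in => /forall_inP ha.
have {}ha a : a \in A -> exists2 f, max_matching A f & f a = a.
  move=> /ha; rewrite negb_forall => /existsP[f].
  by rewrite negb_imply negbK => /andP[? /eqP]; exists f.
(* The classes of this relation are the labels. Adjacent vertices are equivalent, as a maximum
   matching missing both could be enlarged, and the vertices missed by one maximum matching are
   pairwise inequivalent. *)
pose eqv x y := (x == y) || [forall f, max_matching A f ==> ~~ ((f x == x) && (f y == y))].
have eqv_sym x y : eqv x y = eqv y x.
  by rewrite /eqv eq_sym; congr orb; apply: eq_forallb => f; rewrite andbC.
have eqvP x y f : eqv x y -> x != y -> max_matching A f -> f x = x -> f y = y -> False.
  rewrite /eqv => /orP[->//|/forallP/(_ f)/implyP h] _ /h + fx fy.
  by rewrite fx fy !eqxx.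
have eqv_trans x y z : y \in A -> eqv x y -> eqv y z -> eqv x z.
  move=> yA xy yz; rewrite /eqv; case: eqVneq => //= nxz.
  apply/forallP=> f; apply/implyP=> mf; apply/negP=> /andP[/eqP fx /eqP fz].
  case: (eqVneq x y) => [exy|nxy]; first by apply: (eqvP x z f) => //; rewrite exy.
  case: (eqVneq y z) => [eyz|nyz]; first by apply: (eqvP x z f) => //; rewrite -eyz.
  have [g mg gy] := ha y yA.
  have [f' mf' [fy [fx'|fz']]] := gallai_transitive mf mg fx fz nxz gy.
    exact: (eqvP x y f').
  exact: (eqvP y z f').
have [f mf] := max_matching_exists A; have /max_matchingP[mf1 minf] := mf.
exists f, set0, (fun x => [set y in A | eqv y x]); split=> //; first exact: sub0set.
- move=> x y; rewrite setD0 => xA yA exy.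
  have exq : eqv x y.
    rewrite /eqv; case: eqVneq => //= nxy.
    apply/forallP=> g; apply/implyP=> /max_matchingP[mg ming].
    apply/negP=> /andP[/eqP gx /eqP gy]; have gK := matchingK mg.
    pose g' := [ffun z => if z == x then y else if z == y then x else g z].
    have mg' : matching A g'.
      apply: matchingP => z; rewrite !ffunE; case: (eqVneq z x) => [->|zx].
      - by rewrite eq_sym (negPf nxy) eqxx.
      - case: (eqVneq z y) => [->|zy]; first by rewrite eqxx.
        by rewrite -{1}gx -{2}gy !(inj_eq (inv_inj gK)) (negPf zx) (negPf zy) gK.
      - by [].
      - case: (eqVneq z y) => [->|zy]; first by rewrite e_sym.
        exact: matchingE.
    have := ming g' mg'; rewrite leqNgt => /negP; apply; apply: proper_card.
    apply/properP; split.
      apply/subsetP=> z; rewrite !inE ffunE => /andP[zA zz]; rewrite zA /=; move: zz.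
      by case: (eqVneq z x) => [->|_]; rewrite ?gx ?eqxx //;
        case: (eqVneq z y) => [->|_]; rewrite ?gy ?eqxx.
    by exists x; rewrite !inE ?gx ?eqxx ?xA // !ffunE eqxx eq_sym (negPf nxy).
  apply/setP=> z; rewrite !inE; case: (boolP (z \in A)) => //= zA.
  by apply/idP/idP => h; [apply: (eqv_trans z x y)|apply: (eqv_trans z y x)]; rewrite // eqv_sym.
- rewrite cards0 addn0 setD0.
  rewrite -(card_in_imset (f := fun x => [set y in A | eqv y x]) (D := mem (missed A f))).
    by apply/subset_leq_card/imsetS/subsetP=> x; rewrite inE => /andP[].
  move=> x y; rewrite !inE => /andP[xA /eqP fx] /andP[yA /eqP fy] /setP/(_ x).
  rewrite !inE xA /= {1}/eqv eqxx /= => /esym xy; apply/eqP; apply: contraT => nxy.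
  by case: (eqvP x y f).
Qed.

End Matchings.

(** * Two-coloured complete graphs *)

Section TwoColoring.

Variables (V : finType) (red : rel V).
Hypothesis red_sym : symmetric red.
Hypothesis red_irr : irreflexive red.

Definition blue (x y : V) : bool := (x != y) && ~~ red x y.
Definition redN (x : V) : {set V} := [set y | red x y].
Definition blueN (x : V) : {set V} := [set y | blue x y].

Lemma blueE x y : blue x y = (x != y) && ~~ red x y.
Proof. by []. Qed.

Lemma blue_sym : symmetric blue.
Proof. by move=> x y; rewrite /blue eq_sym red_sym. Qed.

Lemma blue_irr : irreflexive blue.
Proof. by move=> x; rewrite /blue eqxx. Qed.

Lemma card_split x (X : {set V}) :
  #|X| = #|redN x :&: X| + #|blueN x :&: X| + (x \in X).
Proof.
rewrite (cardsD1 x X) addnC; congr (_ + _).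
rewrite -(cardsID (redN x) (X :\ x)); congr (_ + _); apply: eq_card => y; rewrite !inE.
  by case: eqVneq => [->|]; rewrite ?red_irr //= andbC.
by rewrite /blue [x == y]eq_sym; case: (y == x); case: (red x y).
Qed.

Lemma red_double_count (A Z : {set V}) a b :
  {in Z, forall z, a <= #|redN z :&: A|} -> {in A, forall x, #|redN x :&: Z| <= b} ->
  #|Z| * a <= #|A| * b.
Proof.
have cE x (X : {set V}) : #|redN x :&: X| = \sum_(y in X) red x y.
  rewrite -sum1_card (eq_bigl (fun y => (y \in X) && red x y)).
    by rewrite big_mkcondr; apply: eq_bigr => y _; case: (red x y).
  by move=> y; rewrite !inE andbC.
move=> hZ hA; apply: (@leq_trans (\sum_(z in Z) \sum_(x in A) red z x)).
  by rewrite -sum_nat_const; apply: leq_sum => z zZ; rewrite -cE; apply: hZ.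
rewrite exchange_big -sum_nat_const /=; apply: leq_sum => x xA.
rewrite (eq_bigr (fun z => nat_of_bool (red x z))) -?cE; first exact: hA.
by move=> z _; rewrite red_sym.
Qed.

Definition common_blue (X K : {set V}) : {set V} :=
  [set y in X | [forall z in K, blue y z]].

Lemma card_common_blue (X K : {set V}) E :
  {in K, forall z, #|redN z :&: X| <= E} ->
  #|X| <= #|common_blue X K| + #|K| * E.+1.
Proof.
move: {2}#|K| (erefl #|K|) => k; elim: k K => [|k IHk] K cK hK.
  have -> : K = set0 by apply/eqP; rewrite -cards_eq0 cK.
  rewrite (_ : common_blue X set0 = X) ?leq_addr //.
  by apply/setP=> y; rewrite inE; case: forall_inP => [_|[]]; rewrite ?andbT // => z; rewrite inE.
have /card_gt0P[z zK] : 0 < #|K| by rewrite cK.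
have cKz : #|K :\ z| = k by move: cK; rewrite (cardsD1 z) zK => -[].
have := IHk _ cKz (fun u hu => hK u (subsetP (subsetDl _ _) _ hu)).
rewrite cK cKz mulSn; set C := common_blue X (K :\ z) => hC.
have -> : common_blue X K = blueN z :&: C.
  apply/setP=> y; rewrite !inE blue_sym; apply/andP/and3P => [[yX /forall_inP h]|].
    by split=> //; [apply: h|apply/forall_inP=> u /setD1P[_ /h]].
  move=> [yz yX /forall_inP h]; split=> //; apply/forall_inP=> u uK.
  by case: (eqVneq u z) => [->//|nu]; apply: h; rewrite !inE nu.
have := card_split z C.
have : #|redN z :&: C| <= E.
  apply: leq_trans (hK z zK); apply/subset_leq_card/setIS.
  by apply/subsetP=> y; rewrite inE => /andP[].
case: (z \in C) => /=; lia.
Qed.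

(** Vertices with distinct labels are joined in blue, so it suffices to choose one vertex per
    label. *)
Lemma label_reps (W : {set V}) (l : V -> {set V}) (L : {set {set V}}) :
  {in W &, forall x y, red x y -> l x = l y} -> L \subset l @: W ->
  exists Q : {set V}, [/\ Q \subset W, #|Q| = #|L|, {in Q, forall x, l x \in L} &
    clique blue Q].
Proof.
move=> hl sL; pose Q := [set x in W | (l x \in L) && ([pick y in W | l y == l x] == Some x)].
have inj : {in Q &, injective l}.
  move=> x y; rewrite !inE => /and3P[_ _ /eqP hx] /and3P[_ _ /eqP hy] lxy.
  by move: hx; rewrite lxy hy => -[].
exists Q; split.
- by apply/subsetP=> x; rewrite inE => /andP[].
- rewrite -(card_in_imset inj); apply: eq_card => u; apply/imsetP/idP.
    by move=> [x]; rewrite inE => /and3P[_ + _] ->.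
  move=> uL; have /imsetP[y yW uy] := subsetP sL _ uL.
  case E : [pick z in W | l z == u] => [x|]; last first.
    by case: pickP E => // /(_ y); rewrite /= yW uy eqxx.
  have [xW xu] : x \in W /\ l x = u by case: pickP E => // z /andP[zW /eqP zu] [<-].
  by exists x => //; rewrite inE xW xu uL E eqxx.
- by move=> x; rewrite inE => /and3P[].
- apply/cliqueP=> x y xQ yQ nxy; rewrite /blue nxy; apply: contraNN nxy => rxy.
  apply/eqP/inj => //; apply: hl => //.
    by move: xQ; rewrite inE => /andP[].
  by move: yQ; rewrite inE => /andP[].
Qed.

(* When each x in A distributes weight 1 evenly over Y x, every y in U receives total
   weight at most b / a. *)
Lemma weighted_double_count (A U : {set V}) (Y : V -> {set V}) a b :
  {in A, forall x, [/\ Y x \subset U, Y x \subset redN x & 0 < #|Y x|]} ->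
  {in A, forall x, {in Y x, forall y, a * #|redN y :&: A| <= b * #|Y x|}} ->
  a * #|A| <= b * #|U|.
Proof.
move=> hY hab.
have: ((a * #|A|)%:R <= (b * #|U|)%:R :> rat)%R; last by rewrite ler_nat.
have eA : ((a * #|A|)%:R = \sum_(x in A) \sum_(y in Y x) a%:R / #|Y x|%:R :> rat)%R.
  rewrite natrM mulrC -sumr_const mulr_suml; apply: eq_bigr => x xA.
  have [_ _ p] := hY x xA; rewrite mul1r sumr_const -[RHS]mulr_natr divfK //.
  by rewrite pnatr_eq0 -lt0n.
rewrite eA (exchange_big_dep (mem U)) /=; last first.
  by move=> x y xA yY; have [/subsetP s _ _] := hY x xA; apply: s.
rewrite natrM mulrC -sumr_const mulr_suml; apply: ler_sum => y yU; rewrite mul1r.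
have [e0|[x0]] := set_0Vmem [set x in A | y \in Y x].
  rewrite big1 ?ler0n // => x /andP[xA yx].
  have : x \in [set x in A | y \in Y x] by rewrite inE xA.
  by rewrite e0 inE.
rewrite inE => /andP[x0A yx0].
have r0 : (0 < #|redN y :&: A|%:R :> rat)%R.
  rewrite ltr0n; apply/card_gt0P; exists x0; rewrite !inE x0A red_sym.
  by have [_ /subsetP s _] := hY _ x0A; have := s _ yx0; rewrite inE => ->.
(* Let d be the number of red neighbours of y in A. At most d vertices x send weight to y, and the
   hypothesis bounds each scaled weight a / |Y x| by b / d. *)
apply: (@le_trans _ _ (\sum_(x in redN y :&: A) b%:R / #|redN y :&: A|%:R)%R); last first.
  by rewrite sumr_const -[leLHS]mulr_natr divfK // gt_eqF.
rewrite [leRHS](bigID (fun x => y \in Y x)) /= -[leLHS]addr0; apply: lerD; last first.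
  by apply: sumr_ge0 => x _; rewrite divr_ge0 ?ler0n.
rewrite [leRHS](eq_bigl (fun x => (x \in A) && (y \in Y x))); last first.
  move=> x; rewrite !inE; case: (boolP (x \in A)) => xA; rewrite ?andbF //= ?andbT.
  case: (boolP (y \in Y x)) => yx; rewrite ?andbF // andbT red_sym.
  by have [_ /subsetP s _] := hY _ xA; have := s _ yx; rewrite inE.
apply: ler_sum => x /andP[xA yx]; have [_ _ p] := hY _ xA.
rewrite ler_pdivrMr ?ltr0n // mulrAC ler_pdivlMr // -!natrM ler_nat.
exact: hab.
Qed.

(** * Greedy construction of blue fans *)

Section SeedFans.

Variables (t n : nat) (w : V).
Hypothesis no_blue : ~ packing blue t n (blueN w).

(** Each seed in Y extends to a blue K_t with one vertex from each of the t - 1 sets [P j]: a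
    partial clique excludes at most [t * E.+1] vertices of [P j], and the vertices to be avoided at
    most [t * n]. So n seeds would give a blue fan at w. *)
Lemma no_fan_from_seeds (I : finType) (J : {set I}) (P : I -> {set V}) (Y : {set V}) E :
  (#|J|).+1 = t -> Y \subset blueN w -> {in J, forall j, P j \subset blueN w} ->
  {in Y, forall y, {in J, forall j, #|redN y :&: P j| <= E}} ->
  {in J &, forall i j, i != j -> {in P i, forall x, #|redN x :&: P j| <= E}} ->
  {in J, forall j, t * E.+1 + t * n < #|P j|} ->
  #|Y| < n.
Proof.
move=> cJ sY sP hYP hPP cP; rewrite ltnNge; apply/negP=> hn; apply: no_blue.
have build (y : V) (D : {set V}) : y \in Y -> #|D| <= t * n ->
    exists K : {set V}, [/\ y \in K, #|K| = t, clique blue K & K :\ y \subset blueN w :\: D].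
  move=> yY cD.
  suff: forall k, k <= #|J| -> exists (J' : {set I}) (K : {set V}),
      [/\ J' \subset J, #|J'| = k, #|K| = k.+1, y \in K & clique blue K /\
       (K :\ y \subset blueN w :\: D /\
        {in K, forall z, {in J :\: J', forall j, #|redN z :&: P j| <= E}})].
    move=> /(_ _ (leqnn _))[J' [K [_ _ cK yK [qK [sK _]]]]].
    by exists K; rewrite cK cJ.
  elim=> [|k IHk] hk.
    exists set0, [set y]; rewrite sub0set cards0 cards1 set11 setDv sub0set.
    split=> //; split; first by apply/cliqueP=> a b; rewrite !inE => /eqP-> /eqP->; rewrite eqxx.
    by split=> // z; rewrite inE => /eqP-> j; rewrite setD0 => jJ; apply: hYP.
  have [J' [K [sJ' cJ' cK yK [qK [sK hK]]]]] := IHk (ltnW hk).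
  have /subsetPn[j jJ jJ'] : ~~ (J \subset J').
    by apply: contraL hk => /subset_leq_card; rewrite cJ' -leqNgt.
  have hE z : z \in K -> #|redN z :&: P j| <= E by move=> zK; apply: hK; rewrite // inE jJ'.
  have := card_common_blue hE; set C := common_blue _ _ => hC.
  have /subsetPn[a aC aD] : ~~ (C \subset D).
    apply/negP=> /subset_leq_card; have := cP j jJ.
    have : #|K| * E.+1 <= t * E.+1 by rewrite leq_mul2r -cJ cK ltnS (ltnW hk) orbT.
    lia.
  move: aC; rewrite inE => /andP[aP /forall_inP aK].
  have naK : a \notin K by apply/negP=> /aK; rewrite blue_irr.
  exists (j |: J'), (a |: K); split.
  - by rewrite subUset sub1set jJ.
  - by rewrite cardsU1 jJ' cJ'.
  - by rewrite cardsU1 naK cK.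
  - by rewrite inE yK orbT.
  split; first by apply: cliqueU1 => //; apply: blue_sym.
  split.
    apply/subsetP=> z; rewrite in_setD1 in_setU1 => /andP[nzy /orP[/eqP->|zK]].
      by rewrite inE aD (subsetP (sP j jJ)).
    by apply: (subsetP sK); rewrite !inE nzy.
  move=> z; rewrite in_setU1 => /orP[/eqP->|zK] i; rewrite !inE negb_or => /andP[/andP[nij nJ] iJ].
    by apply: (hPP j i) => //; rewrite eq_sym.
  by apply: hK; rewrite // inE nJ.
(* D holds the vertices already used; [build] will avoid [D :|: Y'], so that no clique consumes a
   later seed. *)
suff main : forall k (Y' D : {set V}), #|Y'| = k -> Y' \subset Y -> [disjoint Y' & D] ->
    #|D| + t * k <= t * n -> packing blue t k (blueN w :\: D).
  have [Y' sY' cY'] := subset_of_card hn.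
  rewrite -[blueN w]setD0; apply: (main n Y') => //; last by rewrite cards0.
  by rewrite -setI_eq0 setI0.
elim=> // k IHk Y' D cY' sY' dY' cD.
have /card_gt0P[y yY'] : 0 < #|Y'| by rewrite cY'.
have yY := subsetP sY' _ yY'.
have [||K [yK cK qK sK]] := build y (D :|: Y') => //.
  have : #|D :|: Y'| <= #|D| + #|Y'| by rewrite cardsU leq_subr.
  have : k.+1 <= t * k.+1 by rewrite -cJ leq_pmull.
  lia.
have sKD z : z \in K -> z != y -> [/\ z \in blueN w, z \notin D & z \notin Y'].
  move=> zK nzy; have /(subsetP sK) : z \in K :\ y by rewrite !inE nzy.
  by rewrite inE in_setU negb_or => /andP[/andP[-> ->] ->].
exists K.
  apply/and3P; split=> //; last by rewrite cK.
  apply/subsetP=> z zK; rewrite inE; case: (eqVneq z y) => [->|/(sKD z zK)[-> -> _] //].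
  by rewrite (disjointFr dY' yY') (subsetP sY _ yY).
rewrite setDDl; apply: (IHk (Y' :\ y)).
- by move: cY'; rewrite (cardsD1 y) yY' => -[].
- by apply: subset_trans sY'; apply: subsetDl.
- rewrite -setI_eq0; apply/eqP/setP=> z; rewrite !inE; apply/negP.
  move=> /andP[/andP[nzy zY'] /orP[zD|/sKD/(_ nzy)[_ _]]]; last by rewrite zY'.
  by rewrite (disjointFr dY' zY') in zD.
- have : #|D :|: K| <= #|D| + #|K| by rewrite cardsU leq_subr.
  rewrite cK; lia.
Qed.

End SeedFans.

End TwoColoring.

(** * Colourings without fans *)

Section NoFans.

Variables (V : finType) (red : rel V).
Hypothesis red_sym : symmetric red.
Hypothesis red_irr : irreflexive red.
Variables m n t : nat.
Hypothesis no_red : forall x, ~ packing red 2 m (redN red x).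
Hypothesis no_blue : forall x, ~ packing (blue red) t n (blueN red x).

Local Notation blue := (blue red).
Local Notation redN := (redN red).
Local Notation blueN := (blueN red).
Local Notation common_blue := (common_blue red).

Implicit Types (A X Q Y S W : {set V}) (x y z v w q : V).

(** Red matchings in A move at most 2m - 2 vertices, and the Tutte-Berge formula turns this into
    many labels. *)
Lemma red_labels x A : A \subset redN x -> exists S (l : V -> {set V}),
  [/\ S \subset A, {in A :\: S &, forall y z, red y z -> l y = l z} &
      #|A| + #|S| + 2 <= 2 * m + #|l @: (A :\: S)|].
Proof.
move=> sA; have [f [S [l [mf sS hl cl]]]] := tutte_berge red_sym A.
exists S, l; split=> //; have := card_missed mf.
suff : (#|moved f|).+1 < 2 * m by lia.
rewrite ltnNge; apply/negP=> h; apply: (no_red (x := x)).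
by apply: packing_sub sA _; apply: matching_packing mf h.
Qed.

Lemma blue_clique_in_redN x A : A \subset redN x ->
  exists Q, [/\ Q \subset A, clique blue Q & #|A| + 2 <= 2 * m + #|Q|].
Proof.
move=> /red_labels[S [l [sS hl cl]]].
have [Q [sQ cQ _ bQ]] := label_reps hl (subxx _).
exists Q; split=> //; last by rewrite cQ; apply: leq_trans cl; rewrite leq_add2r leq_addr.
by apply: subset_trans sQ _; apply: subsetDl.
Qed.

Lemma clique_free_redN j x X :
  clique_free blue j.+1 X -> #|redN x :&: X| + 2 <= 2 * m + j.
Proof.
move=> fX; have [Q [sQ bQ cQ]] := blue_clique_in_redN (subsetIl (redN x) X).
have := clique_free_card fX (subset_trans sQ (subsetIr _ _)) bQ; lia.
Qed.

Lemma clique_bicolor A Q : clique red A -> clique blue Q -> Q \subset A -> #|Q| <= 1.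
Proof.
move=> /cliqueP rA /cliqueP bQ /subsetP s; apply/card_le1_eqP=> x y xQ yQ.
apply/eqP; apply: contraT => nxy; have := bQ y x yQ xQ nxy.
by rewrite blueE nxy rA ?s.
Qed.

Lemma red_clique_redN A x : clique red A -> x \in A -> (#|redN x :&: A|).+1 = #|A|.
Proof.
move=> rA xA; rewrite (cardsD1 x A) xA add1n; congr _.+1; apply: eq_card => y.
rewrite !inE; case: eqVneq => [->|nyx]; first by rewrite red_irr.
by case: (boolP (y \in A)) => yA; rewrite ?andbF //= (cliqueP _ _ rA) // eq_sym.
Qed.

(** Q is a blue K_{t-1} found greedily. A blue edge inside a core would complete a blue K_t with
    [Q :\ q], and a vertex in two cores would be blue to all of Q. Each vertex of Q excludes only
    about 2m vertices of X. *)
Lemma core_cliques X k : 1 < t -> clique_free blue t X ->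
  t * (2 * m) <= #|X| + k + 2 * m -> k + t * t < 2 * m ->
  exists Q, [/\ Q \subset X, (#|Q|).+1 = t,
   {in Q, forall q, clique red (common_blue X (Q :\ q))},
   {in Q, forall q, 2 * m <= #|common_blue X (Q :\ q)| + k + t * t} &
   {in Q &, forall q q', q != q' ->
      [disjoint common_blue X (Q :\ q) & common_blue X (Q :\ q')]}].
Proof.
move=> t1 fX cX km; case: t t1 fX cX km => // j j0 fX cX km.
have cb (Q : {set V}) : #|X| <= #|common_blue X Q| + #|Q| * (2 * m + j).
  have h z : z \in Q -> #|redN z :&: X| <= 2 * m + j - 2.
    by have := clique_free_redN z fX; lia.
  have := card_common_blue red_sym red_irr h.
  rewrite (_ : (2 * m + j - 2).+1 = 2 * m + j - 1); last by lia.
  move=> /leq_trans; apply; rewrite leq_add2l leq_mul2l; apply/orP; right; lia.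
have [Q [sQ cQ bQ]] : exists Q, [/\ Q \subset X, #|Q| = j & clique blue Q].
  suff: forall i, i <= j -> exists Q, [/\ Q \subset X, #|Q| = i & clique blue Q].
    by apply.
  elim=> [|i IHi] hi.
    exists set0; rewrite sub0set cards0; split=> //.
    by apply/cliqueP=> x y; rewrite inE.
  have [Q [sQ cQ bQ]] := IHi (ltnW hi).
  have /card_gt0P[a] : 0 < #|common_blue X Q|.
    have := cb Q; rewrite cQ; move: cX km hi; clear; nia.
  rewrite inE => /andP[aX /forall_inP aQ].
  have naQ : a \notin Q by apply/negP=> /aQ; rewrite blue_irr.
  exists (a |: Q); rewrite subUset sub1set aX cardsU1 naQ cQ; split=> //.
  by apply: cliqueU1 => //; apply: blue_sym.
have ext y : y \in X -> {in Q, forall z, blue y z} -> False.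
  move=> yX yQ.
  have nyQ : y \notin Q by apply/negP=> /yQ; rewrite blue_irr.
  have : #|y |: Q| < j.+1.
    apply: clique_free_card fX _ _; first by rewrite subUset sub1set yX.
    by apply: cliqueU1 => //; apply: blue_sym.
  by rewrite cardsU1 nyQ cQ ltnn.
exists Q; split=> //.
- by rewrite cQ.
- move=> q qQ; apply/cliqueP=> x y; rewrite !inE.
  move=> /andP[xX /forall_inP xQ] /andP[yX /forall_inP yQ] nxy.
  apply: contraT => nr.
  have : #|x |: (y |: (Q :\ q))| < j.+1.
    apply: clique_free_card fX _ _.
      rewrite !subUset !sub1set xX yX /=.
      by apply: subset_trans sQ; apply: subsetDl.
    apply: cliqueU1; first exact: blue_sym.
      move=> z; rewrite in_setU1 => /orP[/eqP->|/xQ //].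
      by rewrite blueE nxy.
    apply: cliqueU1 => //; first exact: blue_sym.
    by apply: sub_clique bQ; apply: subsetDl.
  have n1 : x \notin Q :\ q by apply/negP=> /xQ; rewrite blue_irr.
  have n2 : y \notin Q :\ q by apply/negP=> /yQ; rewrite blue_irr.
  rewrite !cardsU1 in_setU1 negb_or nxy n1 n2.
  by move: cQ; rewrite (cardsD1 q) qQ; lia.
- move=> q qQ; have := cb (Q :\ q).
  have -> : #|Q :\ q| = j.-1 by move: cQ; rewrite (cardsD1 q) qQ; lia.
  move: cX j0; clear; nia.
- move=> q q' qQ q'Q nq; rewrite -setI_eq0; apply/eqP/setP=> y; rewrite !inE.
  apply/negP=> /andP[/andP[yX /forall_inP y1] /andP[_ /forall_inP y2]].
  apply: (ext y yX) => z zQ; case: (eqVneq z q) => [->|nzq].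
    by apply: y2; rewrite !inE nq.
  by apply: y1; rewrite !inE nzq.
Qed.

Lemma clique_free_blueN v : exists X,
  [/\ X \subset blueN v, clique_free blue t X &
      #|V| + t <= #|X| + #|redN v| + 1 + t * n].
Proof.
have [T [sT cT fT]] := packing_hitting (no_blue (x := v)).
exists (blueN v :\: T); split=> //; first exact: subsetDl.
have := card_split red_irr v [set: V]; rewrite !setIT cardsT inE.
rewrite cardsD (setIidPr sT); have := subset_leq_card sT; lia.
Qed.

Lemma blue_clique_card Q : clique blue Q -> #|Q| <= t * n.
Proof.
move=> bQ; rewrite leqNgt; apply/negP=> cQ.
have /card_gt0P[x xQ] : 0 < #|Q| by apply: leq_ltn_trans cQ.
apply: (no_blue (x := x)); apply: (@packing_sub _ _ _ _ (Q :\ x)).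
  apply/subsetP=> y; rewrite !inE => /andP[nyx yQ].
  by apply: (cliqueP _ _ bQ) => //; rewrite eq_sym.
apply: clique_packing; first by apply: sub_clique bQ; apply: subsetDl.
by move: cQ; rewrite (cardsD1 x) xQ.
Qed.

(* Y takes one vertex from every component of redN x - S that avoids X. *)
Lemma outer_blue_clique X A x : 0 < t -> clique_free blue t X -> A \subset X ->
  clique red A -> x \in A -> 2 * m <= #|redN x| ->
  exists Y S, [/\ Y \subset redN x :\: X, clique blue Y,
    #|redN x| + #|S| + 3 <= 2 * m + #|Y| + t, #|S| + #|A| <= 2 * m &
    {in Y, forall y, redN y :&: A \subset x |: S}].
Proof.
move=> t0 fX sAX rA xA hd; have [S [l [sS hl cl]]] := red_labels (subxx (redN x)).
set W := redN x :\: S in hl cl.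
have sub_reps (Z : {set V}) : Z \subset W ->
    exists Q, [/\ Q \subset Z, #|Q| = #|l @: Z| & clique blue Q].
  move=> sZ; have hlZ : {in Z &, forall y z, red y z -> l y = l z}.
    by move=> y z /(subsetP sZ) ? /(subsetP sZ) ?; apply: hl.
  by have [Q [? ? _ ?]] := label_reps hlZ (subxx _); exists Q.
(* Representatives of the labels occurring in X form a blue clique in X, so fewer than t labels are
   lost. *)
have cX : #|l @: (W :&: X)| < t.
  have [Q [sQ <- bQ]] := sub_reps _ (subsetIl W X).
  by apply: clique_free_card fX _ bQ; apply: subset_trans sQ (subsetIr _ _).
have cA : #|l @: (W :&: A)| <= 1.
  have [Q [sQ <- bQ]] := sub_reps _ (subsetIl W A).
  by apply: clique_bicolor rA bQ _; apply: subset_trans sQ (subsetIr _ _).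
have [Y [sY cY lY bY]] :=
  label_reps hl (subsetDl (l @: W) (l @: (W :&: X))).
exists Y, S; split=> //.
- apply/subsetP=> y yY; have yW := subsetP sY _ yY.
  rewrite inE; apply/andP; split; last by move: yW; rewrite inE => /andP[].
  apply/negP=> yX; have := lY y yY; rewrite inE => /andP[/negP nl _].
  by case: nl; apply: imset_f; rewrite inE yW.
- have : #|l @: W| <= #|Y| + #|l @: (W :&: X)|.
    by rewrite cY cardsD addnC -leq_subLR leq_sub2l // subset_leq_card ?subsetIr.
  move: cl cX; move: #|l @: W| #|l @: (W :&: X)|; lia.
(* The red clique A carries at most one label, so few labels are available and [red_labels] forces S
   to be small. *)
- have h1 : #|l @: W| <= 1 + #|redN x :\: A|.
    have -> : l @: W = l @: (W :&: A) :|: l @: (W :\: A) by rewrite -imsetU setID.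
    rewrite cardsU; apply: leq_trans (leq_subr _ _) _; apply: leq_add => //.
    apply: leq_trans (leq_imset_card _ _) _; apply/subset_leq_card/setSD/subsetDl.
  have := red_clique_redN rA xA.
  have := cardsID A (redN x); lia.
- move=> y yY; apply/subsetP=> a; rewrite !inE => /andP[rya aA].
  case: eqVneq => //= nax; apply: contraT => aS.
  have aW : a \in W by rewrite !inE aS (cliqueP _ _ rA) // eq_sym.
  have := lY y yY; rewrite inE (hl y a (subsetP sY _ yY) aW rya) => /andP[/negP nl _].
  by case: nl; apply: imset_f; rewrite inE aW (subsetP sAX).
Qed.

(** A larger Y would give a fan centred in Y: each K_t takes t - 1 other vertices of Y and one
    vertex of A outside [x |: S]. *)
Lemma outer_blue_clique_card A Y S x : 0 < t -> clique blue Y -> [disjoint Y & A] ->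
  {in Y, forall y, redN y :&: A \subset x |: S} -> n + #|S| + 1 <= #|A| ->
  #|Y| <= (t - 1) * n.
Proof.
move=> t0 bY dYA hY cA; rewrite leqNgt; apply/negP=> cY.
have /card_gt0P[y0 y0Y] : 0 < #|Y| by apply: leq_ltn_trans cY.
have bYA : {in Y & A :\: (x |: S), forall y a, blue y a}.
  move=> y a yY; rewrite inE => /andP[nS aA]; rewrite blueE; apply/andP; split.
    by apply: contraTneq aA => <-; rewrite (disjointFr dYA yY).
  by apply: contra nS => rya; apply: (subsetP (hY y yY)); rewrite !inE rya.
apply: (no_blue (x := y0)).
apply: (@packing_sub _ _ _ _ ((Y :\ y0) :|: (A :\: (x |: S)))).
  apply/subsetP=> z; rewrite in_setU inE => /orP[|zA]; last by rewrite inE bYA.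
  rewrite !inE => /andP[nz zY]; apply: (cliqueP _ _ bY) => //; by rewrite eq_sym.
have -> : t = (t - 1).+1 by lia.
apply: clique_join_packing.
- exact: blue_sym.
- by apply: sub_clique bY; apply: subsetDl.
- by move=> y a /setD1P[_ yY]; apply: bYA.
- by apply: disjointWl (subsetDl _ _) _; apply: disjointWr dYA; apply: subsetDl.
- by move: cY; rewrite (cardsD1 y0) y0Y; lia.
- rewrite cardsD; have : #|A :&: (x |: S)| <= #|x |: S| by apply/subset_leq_card/subsetIr.
  by have := cardsU1 x S; case: (x \notin S); lia.
Qed.

Hypothesis t3 : 2 < t.
Hypothesis cV : #|V| = t * (2 * m + n).
Hypothesis n0 : 0 < n.
Hypothesis mn : 4 * (t * n) <= 2 * m + 4 * n + t * t.

(* Let M + k be the least red degree. Every vertex x of a core clique A sends red edges to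
   a blue clique Y of about k + s vertices outside X, each with at most about
   s <= min k ((t - 1) n - k) red neighbours in A; weighting these edges by 1 / #|Y|
   shows that the complement of X would be too large. *)
Lemma low_red_degree : 1000 * (t * t) <= 2 * m ->
  exists v, #|redN v| <= 2 * m + 31 * (t * t).
Proof.
move=> mt.
have /card_gt0P[v0 _] : 0 < #|V| by rewrite cV; nia.
case: (@arg_minnP _ v0 predT (fun x => #|redN x|) isT) => v _ minv.
exists v; rewrite leqNgt; apply/negP=> hk.
have {minv} minv x : #|redN v| <= #|redN x| by apply: minv.
have [k dv] : exists k, #|redN v| = 2 * m + k.
  by exists (#|redN v| - 2 * m); lia.
rewrite dv ltn_add2l in hk minv.
have t3n : 3 * n <= t * n by rewrite leq_mul2r t3 orbT.
have tt3 : 3 * t <= t * t by rewrite leq_mul2r t3 orbT.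
have ktn : k + 2 <= t * n.
  have [Q [_ bQ cQ]] := blue_clique_in_redN (subxx (redN v)).
  by have := blue_clique_card bQ; lia.
have [X [sX fX cX]] := clique_free_blueN v.
have cX' : t * (2 * m) <= #|X| + k + 2 * m by move: cX; rewrite dv cV mulnDr; lia.
have [||Q [sQ cQ rA cA _]] := core_cliques _ fX cX'; [lia|lia|].
have /card_gt0P[q qQ] : 0 < #|Q| by lia.
move: (rA q qQ) (cA q qQ); set A := common_blue X (Q :\ q) => {}rA {}cA.
have sAX : A \subset X by apply/subsetP=> y; rewrite inE => /andP[].
have hY x : x \in A -> exists Y, [/\ Y \subset redN x :\: X, #|Y| <= (t - 1) * n &
    exists s, [/\ k + s + 2 <= #|Y| + t, s <= k + t * t + 1, 0 < s &
    {in Y, forall y, #|redN y :&: A| <= s}]].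
  move=> xA; have [||Y [S [sY bY cY cS hY]]] := outer_blue_clique _ fX sAX rA xA.
  - lia.
  - have := minv x; lia.
  have dYA : [disjoint Y & A].
    rewrite -setI_eq0; apply/eqP/setP=> y; rewrite in_setI in_set0.
    apply/negP=> /andP[/(subsetP sY)].
    by rewrite in_setD => /andP[nX _] /(subsetP sAX); rewrite (negPf nX).
  exists Y; split=> //.
    apply: (outer_blue_clique_card _ bY dYA hY); lia.
  exists (#|S| + 1); split; [have := minv x; lia|lia|lia|].
  move=> y /hY/subset_leq_card; have := cardsU1 x S; case: (x \notin S); lia.
have [Y {}hY] : exists Y : V -> {set V}, forall x, x \in A ->
    [/\ Y x \subset redN x :\: X, #|Y x| <= (t - 1) * n &
    exists s, [/\ k + s + 2 <= #|Y x| + t, s <= k + t * t + 1, 0 < s &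
    {in Y x, forall y, #|redN y :&: A| <= s}]].
  apply: (@fin_all_exists V (fun=> {set V}) (fun x Yx => x \in A ->
    [/\ Yx \subset redN x :\: X, #|Yx| <= (t - 1) * n &
    exists s, [/\ k + s + 2 <= #|Yx| + t, s <= k + t * t + 1, 0 < s &
    {in Yx, forall y, #|redN y :&: A| <= s}]])) => x.
  by case: (boolP (x \in A)) => [/hY[Y ?]|nx]; [exists Y|exists set0].
have hsub : {in A, forall x, [/\ Y x \subset ~: X, Y x \subset redN x & 0 < #|Y x|]}.
  move=> x /hY[sY _ [s [h _ _ _]]]; split; last by lia.
    by apply: subset_trans sY _; apply/subsetP=> y; rewrite !inE => /andP[].
  by apply: subset_trans sY _; apply: subsetDl.
have cU : #|~: X| <= 2 * m + t * n + k.
  by have := cardsC X; move: cX; rewrite dv cV mulnDr; lia.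
have e1 : (t - 1) * n = t * n - n by rewrite mulnBl mul1n.
(* Up to lower terms |Y| >= k + s, with s <= (t - 1)n - k and s <= k. For large k the first bound on
   s gives |Y| >= 3s, otherwise the second gives |Y| >= 2s. The ratios 5/2 and 31/16 leave room for
   the lower terms, as k exceeds 31t^2. *)
have [k1|k1] := leqP (2 * ((t - 1) * n)) (3 * k).
  have hc : {in A, forall x, {in Y x, forall y, 5 * #|redN y :&: A| <= 2 * #|Y x|}}.
    by move=> x /hY[_ h1 [s [h2 h3 h4 h5]]] y /h5; lia.
  have kn : k <= t * n - n + t.
    have /card_gt0P[x /hY[_ h1 [s [h2 h3 h4 h5]]]] : 0 < #|A| by lia.
    by lia.
  have := weighted_double_count red_sym hsub hc; lia.
have hc : {in A, forall x, {in Y x, forall y, 31 * #|redN y :&: A| <= 16 * #|Y x|}}.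
  by move=> x /hY[_ h1 [s [h2 h3 h4 h5]]] y /h5; lia.
have := weighted_double_count red_sym hsub hc; lia.
Qed.

(** * Colourings with t nearly red clusters *)

Section Clusters.

Variables (I : finType) (J : {set I}) (A : I -> {set V}) (G : nat).
Hypothesis cJ : #|J| = t.
Hypothesis cA : {in J, forall i, 2 * m <= #|A i| + G}.
Hypothesis dA : {in J &, forall i j, i != j -> [disjoint A i & A j]}.
Hypothesis bA : {in J, forall i, {in A i, forall x, #|blueN x :&: A i| < n}}.
Hypothesis nG : n <= G.
Hypothesis large_m : 20 * (t * G) + 10 * t + 20 * G + 10 < 2 * m.

Lemma blue_clique_sparse (W Q : {set V}) : {in W, forall x, #|blueN x :&: W| < n} ->
  clique blue Q -> Q \subset W -> #|Q| <= n.
Proof.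
move=> hW bQ sQ; have [->|[x xQ]] := set_0Vmem Q; first by rewrite cards0.
rewrite (cardsD1 x) xQ; apply: leq_ltn_trans (hW x (subsetP sQ _ xQ)).
apply/subset_leq_card/subsetP=> y; rewrite !inE => /andP[nyx yQ].
by rewrite (subsetP sQ) // (cliqueP _ _ bQ) // eq_sym.
Qed.

(** A blue clique meets each cluster in at most n vertices, so the one found in the red
    neighbourhood has at most 2n. *)
Lemma redN_clusters w i j : i \in J -> j \in J -> i != j ->
  #|redN w :&: A i| + #|redN w :&: A j| <= 2 * m + 2 * n.
Proof.
move=> iJ jJ nij.
have [Q [sQ bQ]] := blue_clique_in_redN (subsetIl (redN w) (A i :|: A j)).
have /eqP e0 : (redN w :&: A i) :&: (redN w :&: A j) == set0.
  rewrite setI_eq0; apply: disjointWl (subsetIr _ _) _.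
  by apply: disjointWr (subsetIr _ _) _; apply: dA.
rewrite setIUr cardsU e0.
rewrite cards0 subn0.
have hQ k : k \in J -> #|Q :&: A k| <= n.
  move=> kJ; apply: (blue_clique_sparse (bA kJ)); last exact: subsetIr.
  by apply: sub_clique bQ; apply: subsetIl.
have : #|Q| <= #|Q :&: A i| + #|Q :&: A j|.
  rewrite -{1}(setIidPl (subset_trans sQ (subsetIr _ _))) setIUr cardsU; exact: leq_subr.
have := hQ i iJ; have := hQ j jJ; lia.
Qed.

Lemma redN_other_cluster w i j : i \in J -> j \in J -> i != j ->
  #|blueN w :&: A i| < n -> #|redN w :&: A j| <= 4 * G.
Proof.
move=> iJ jJ nij; have := redN_clusters w iJ jJ nij; have := cA iJ.
by have := card_split red_irr w (A i); case: (w \in A i); lia.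
Qed.

(** The vertices of Y have few red neighbours in the other clusters, so they are seeds that extend
    through those t - 1 clusters. *)
Lemma large_cluster_free w i (Y : {set V}) : i \in J -> Y \subset blueN w ->
  {in J :\ i, forall j, 4 * G * t + 2 * t * G + t < #|blueN w :&: A j|} ->
  {in Y, forall y, #|blueN y :&: A i| < n} -> #|Y| < n.
Proof.
move=> iJ sY hw hY.
apply: (no_fan_from_seeds red_sym red_irr (no_blue (x := w))
  (J := J :\ i) (P := fun j => blueN w :&: A j) (E := 4 * G)) => //.
- by rewrite -cJ (cardsD1 i J) iJ.
- by move=> j _; apply: subsetIl.
- move=> y /hY by_ j /setD1P[nji jJ].
  apply: leq_trans (redN_other_cluster iJ jJ _ by_); last by rewrite eq_sym.
  by apply/subset_leq_card/setIS/subsetIr.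
- move=> j k /setD1P[_ jJ] /setD1P[_ kJ] njk x /setIP[_ xA].
  apply: leq_trans (redN_other_cluster jJ kJ njk (bA jJ xA)).
  by apply/subset_leq_card/setIS/subsetIr.
- move=> j /hw; apply: leq_ltn_trans.
  have : t * n <= t * G by rewrite leq_mul2l nG orbT.
  lia.
Qed.

(** Take i with the fewest blue neighbours of w. By [redN_clusters], [A i] and any other cluster
    together contain at least about 2m of them, so the other one has at least about m. *)
Lemma cluster_of w : exists2 i, i \in J & #|blueN w :&: A i| < n.
Proof.
have /card_gt0P[i0 i0J] : 0 < #|J| by rewrite cJ; lia.
case: (arg_minnP (fun i => #|blueN w :&: A i|) i0J) => i iJ mini.
exists i => //; apply: (large_cluster_free iJ (subsetIl _ _)); last first.
  by move=> y /setIP[_ yA]; apply: bA.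
move=> j /setD1P[nji jJ]; have := mini j jJ.
have := redN_clusters w jJ iJ nji; have := cA iJ; have := cA jJ.
have := card_split red_irr w (A i); have := card_split red_irr w (A j).
by case: (w \in A i); case: (w \in A j); lia.
Qed.

Lemma no_clusters : False.
Proof.
pose T i := [set w | #|blueN w :&: A i| < n].
have hT i : i \in J -> {in T i, forall w, #|blueN w :&: T i| < n}.
  move=> iJ w; rewrite inE => wT; apply: (large_cluster_free iJ (subsetIl _ _)).
    move=> j /setD1P[nji jJ]; have := cA jJ.
    have : #|redN w :&: A j| <= 4 * G by apply: redN_other_cluster wT => //; rewrite eq_sym.
    by have := card_split red_irr w (A j); case: (w \in A j); lia.
  by move=> y /setIP[_]; rewrite inE.
have [i iJ cT] : exists2 i, i \in J & 2 * m + n <= #|T i|.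
  apply/exists_inP; apply: contraT; rewrite negb_exists_in => /forall_inP h.
  have : #|[set: V]| <= #|J| * (2 * m + n - 1).
    apply: (card_cover_le (F := T)) => [w _|i /h]; last by lia.
    by have [i iJ wi] := cluster_of w; exists i; rewrite ?inE.
  rewrite cardsT cV cJ leq_mul2l; lia.
have /card_gt0P[w wT] : 0 < #|T i| by lia.
have : 2 * m <= #|redN w :&: T i|.
  have := hT i iJ w wT; have := card_split red_irr w (T i); rewrite wT; lia.
move=> /subset_of_card[B sB cB].
have [S [l [sS hl cl]]] := red_labels (subset_trans sB (subsetIl _ _)).
have sBT : B \subset T i by apply: subset_trans sB (subsetIr _ _).
have [Q [sQ cQ _ bQ]] := label_reps hl (subxx _).
have cQn : #|Q| <= n.
  apply: (blue_clique_sparse (hT i iJ)) => //; apply: subset_trans sQ _.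
  by apply: subset_trans sBT; apply: subsetDl.
rewrite -cQ cB in cl.
(* There are at least |S| + 2 labels, and at most n. A vertex red to both a and b would equate their
   labels, so [B :\: S] has at most 2n vertices. *)
have : 1 < #|l @: (B :\: S)| by rewrite -cQ; lia.
move=> /card_gt1P[_ [_ [/imsetP[a aW ->] /imsetP[b bW ->] nab]]].
have : #|B :\: S| <= #|(a |: (blueN a :&: T i)) :|: (b |: (blueN b :&: T i))|.
  apply/subset_leq_card/subsetP=> z zW; rewrite !inE.
  have zT : #|blueN z :&: A i| < n.
    by have : z \in T i; [apply: (subsetP sBT); case/setDP: zW|rewrite inE].
  rewrite zT !andbT !blueE ![_ == z]eq_sym.
  case: eqVneq => //= _; case: eqVneq => //= [_|_]; rewrite ?orbT //.
  case: (boolP (red a z)) => //= raz; apply: contra nab => rbz.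
  by rewrite (hl a z) // (hl b z).
have aT : a \in T i by apply: (subsetP sBT); case/setDP: aW.
have bT : b \in T i by apply: (subsetP sBT); case/setDP: bW.
rewrite cardsU !cardsU1 !inE !blue_irr /=; have := hT i iJ a aT; have := hT i iJ b bT.
have : #|B| - #|S| <= #|B :\: S|.
  by rewrite cardsD leq_sub2l // subset_leq_card // subsetIr.
rewrite cB; lia.
Qed.

End Clusters.

(** Outliers of a core send more than about 2m / (2t + 2) red edges into it, while each of its at
    most 2m + t vertices receives at most [32 * (t * t)] of them. *)
Definition outlier_bound := 32 * (t * t) * (3 * t + 2).
(* Bounds both n and the number of vertices that a cluster may lack to have 2m vertices. *)
Definition cluster_defect := 63 * (t * t) + t * (t + outlier_bound).
Hypothesis large_m : 20 * (t * cluster_defect) + 10 * t + 20 * cluster_defect + 10 < 2 * m.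

Lemma core_card X A : clique_free blue t X -> A \subset X -> clique red A ->
  #|A| <= 2 * m + t.
Proof.
move=> fX sAX rA.
have [->|[x xA]] := set_0Vmem A; first by rewrite cards0.
have e : t = (t - 1).+1 by lia.
have := clique_free_redN x (j := t - 1); rewrite -e => /(_ X fX).
have := red_clique_redN rA xA.
have : #|redN x :&: A| <= #|redN x :&: X| by apply/subset_leq_card/setIS.
lia.
Qed.

(** Outside S, the red neighbours of x in A share one label, and each outlier red to x has a red
    neighbour among them, hence the same label. With a single label, [red_labels] leaves at most 2m
    - 1 red neighbours of x in A and O. *)
Lemma core_outliers_redN A r x : clique red A -> 2 * m <= #|A| + 32 * (t * t) ->
  32 * (t * t) < r -> x \in A ->
  #|redN x :&: ([set w | r < #|redN w :&: A|] :\: A)| <= 32 * (t * t).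
Proof.
move=> rA cA hr xA; set O := _ :\: A.
have [S [l [sS hl cl]]] := red_labels (subsetIl (redN x) (A :|: O)).
set W := _ :\: S in hl cl.
have dAO : [disjoint redN x :&: A & redN x :&: O].
  rewrite -setI_eq0; apply/eqP/setP=> y; rewrite !inE.
  by case: (y \in A); rewrite ?andbF.
have eB : #|redN x :&: (A :|: O)| = #|redN x :&: A| + #|redN x :&: O|.
  by rewrite -setI_eq0 in dAO; rewrite setIUr cardsU (eqP dAO) cards0 subn0.
have cWA : #|l @: (W :&: A)| <= 1.
  have hlA : {in W :&: A &, forall y z, red y z -> l y = l z}.
    by move=> y z /setIP[yW _] /setIP[zW _]; apply: hl.
  have [Q [sQ <- _ bQ]] := label_reps hlA (subxx _).
  by apply: clique_bicolor rA bQ _; apply: subset_trans sQ (subsetIr _ _).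
have cS : #|S| <= 32 * (t * t).
  have : #|l @: W| <= 1 + #|redN x :&: O|.
    have -> : l @: W = l @: (W :&: A) :|: l @: (W :\: A) by rewrite -imsetU setID.
    rewrite cardsU; apply: leq_trans (leq_subr _ _) _; apply: leq_add => //.
    apply: leq_trans (leq_imset_card _ _) _; apply/subset_leq_card/subsetP=> y.
    case/setDP=> /setDP[/setIP[yR /setUP[yA|yO]] _] nA; first by rewrite yA in nA.
    by rewrite in_setI yR.
  by have := red_clique_redN rA xA; lia.
have eW : l @: W \subset l @: (W :&: A).
  apply/subsetP=> _ /imsetP[y yW ->].
  case: (boolP (y \in A)) => yA; first by apply: imset_f; rewrite inE yW.
  have cy : r < #|redN y :&: A|.
    by move: yW; rewrite !inE (negPf yA) /= => /andP[_ /andP[_]].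
  have /subsetPn[a] : ~~ (redN y :&: A \subset x |: S).
    apply/negP=> /subset_leq_card; have := cardsU1 x S; case: (x \notin S); lia.
  rewrite !inE negb_or => /andP[rya aA] /andP[nax naS].
  have aW : a \in W by rewrite !inE naS aA (cliqueP _ _ rA) // eq_sym.
  by rewrite (hl y a) //; apply: imset_f; rewrite inE aW.
have := subset_leq_card eW; have := red_clique_redN rA xA; lia.
Qed.

(* At a vertex v of small red degree the core cliques have almost 2m vertices. All
   vertices with few red neighbours in every core form the last cluster Z; since v lies
   in Z, its red degree bounds n by a constant depending on t only. *)
Lemma fans_unavoidable : False.
Proof.
have tt3 : 3 * t <= t * t by rewrite leq_mul2r t3 orbT.
have lt2 : 1000 * (t * t) <= 2 * m.
  apply: leq_trans (ltnW large_m); rewrite /cluster_defect; nia.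
have [v dv] := low_red_degree lt2.
have [X [sX fX cX]] := clique_free_blueN v.
have cX' : t * (2 * m) <= #|X| + 31 * (t * t) + 2 * m.
  by move: cX; rewrite cV mulnDr; lia.
have [||Q [sQ cQ rA cA dA]] := core_cliques _ fX cX'; [lia|lia|].
pose A q := common_blue X (Q :\ q).
have sAX q : A q \subset X by apply/subsetP=> y; rewrite inE => /andP[].
have {}cA : {in Q, forall q, 2 * m <= #|A q| + 32 * (t * t)}.
  by move=> q /cA; rewrite -/(A q); lia.
have {}rA : {in Q, forall q, clique red (A q)} by [].
have {}dA : {in Q &, forall q q', q != q' -> [disjoint A q & A q']} by [].
clearbody A.
(* With this threshold (t + 1)r is at most m, half the approximate size of a core, which leaves room
   for the [t * n] in [no_fan_from_seeds]. *)
pose r := (2 * m) %/ (2 * t + 2).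
have r1 : r * (2 * t + 2) <= 2 * m by apply: leq_trunc_div.
have r2 : 2 * m < r.+1 * (2 * t + 2) by apply: ltn_ceil; lia.
have r3 : 32 * (t * t) + t < r.
  rewrite /r leq_divRL; last by lia.
  apply: leq_trans (ltnW large_m); rewrite /cluster_defect /outlier_bound; nia.
have t3n : 3 * n <= t * n by rewrite leq_mul2r t3 orbT.
pose Z := [set w | [forall q in Q, #|redN w :&: A q| <= r]].
have bZ : {in Z, forall w, #|blueN w :&: Z| < n}.
  move=> w; rewrite inE => /forall_inP wZ.
  apply: (no_fan_from_seeds red_sym red_irr (no_blue (x := w))
    (J := Q) (P := fun q => blueN w :&: A q) (E := r)) => //.
  - exact: subsetIl.
  - by move=> q _; apply: subsetIl.
  - move=> y /setIP[_]; rewrite inE => /forall_inP yZ q /yZ; apply: leq_trans.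
    by apply/subset_leq_card/setIS/subsetIr.
  - move=> q q' qQ q'Q nq x /setIP[_ xA].
    have e : t = (t - 1).+1 by lia.
    have := clique_free_redN x (j := t - 1); rewrite -e => /(_ X fX).
    have := red_clique_redN (rA q qQ) xA; have := cA q qQ.
    have : #|redN x :&: A q| + #|redN x :&: (blueN w :&: A q')| <= #|redN x :&: X|.
      rewrite -(cardsID (A q) (redN x :&: X)); apply: leq_add; apply/subset_leq_card/subsetP=> y.
        by rewrite !inE => /andP[-> yA]; rewrite (subsetP (sAX q)) // yA.
      rewrite !inE => /and3P[-> _ yA]; rewrite (subsetP (sAX q')) // !andbT.
      by rewrite (disjointFl (dA q q' qQ q'Q nq) yA).
    lia.
  - move=> q qQ; have := wZ q qQ; have := cA q qQ; have := card_split red_irr w (A q).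
    by case: (w \in A q); lia.
pose O q := [set w | r < #|redN w :&: A q|] :\: A q.
have cO q : q \in Q -> #|O q| <= outlier_bound.
  move=> qQ; have hr : 32 * (t * t) < r by lia.
  have h1 : {in O q, forall z, r.+1 <= #|redN z :&: A q|} by move=> z; rewrite !inE => /andP[].
  have h2 : {in A q, forall x, #|redN x :&: O q| <= 32 * (t * t)}.
    by move=> x xA; apply: (core_outliers_redN (rA q qQ) (cA q qQ) hr xA).
  have := red_double_count red_sym h1 h2.
  have := core_card fX (sAX q) (rA q qQ).
  rewrite -(leq_pmul2r (m := r.+1)) // /outlier_bound.
  move: #|O q| #|A q| r2; clear -t3; nia.
have vZ : v \in Z.
  rewrite inE; apply/forall_inP=> q qQ; rewrite (_ : _ :&: _ = set0) ?cards0 //.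
  apply/setP=> y; rewrite !inE; apply/negP=> /andP[rvy /(subsetP (sAX q))/(subsetP sX)].
  by rewrite inE blueE rvy andbF.
have cZ : #|V| <= #|Z| + (t - 1) * (2 * m + t + outlier_bound).
  rewrite -(cardsC Z) leq_add2l.
  have -> : t - 1 = #|Q| by lia.
  apply: (card_cover_le (F := fun q => A q :|: O q)) => [w|q qQ].
    rewrite !inE negb_forall_in => /exists_inP[q qQ]; rewrite -ltnNge => hw.
    by exists q => //; rewrite !inE hw andbT orbN.
  rewrite cardsU; apply: leq_trans (leq_subr _ _) _; apply: leq_add; last exact: cO.
  exact: core_card fX (sAX q) (rA q qQ).
have cZ' : 2 * m + t * n <= #|Z| + t * (t + outlier_bound).
  by move: cZ; rewrite cV; move: outlier_bound #|Z|; clear -t3; nia.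
(* Z has almost 2m + tn vertices, but v has fewer than n blue neighbours in Z and red degree at most
   2m + 31t^2; this bounds (t - 1)n. *)
have nG : n <= cluster_defect.
  have := bZ v vZ; have := card_split red_irr v Z; rewrite vZ.
  have : #|redN v :&: Z| <= #|redN v| by apply/subset_leq_card/subsetIl.
  rewrite /cluster_defect; lia.
apply: (@no_clusters (option V) (None |: (Some @: Q))
  (fun i => if i is Some q then A q else Z) cluster_defect) => //.
- rewrite cardsU1 card_imset; last by move=> ? ? [].
  by rewrite (_ : None \notin _) //; apply/imsetP=> -[].
- move=> [q|]; rewrite !inE //=; last by move=> _; rewrite /cluster_defect; lia.
  by rewrite mem_imset; [move=> /cA; rewrite /cluster_defect; lia|move=> ? ? []].
- have dZ q : q \in Q -> [disjoint Z & A q].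
    move=> qQ; rewrite -setI_eq0; apply/eqP/setP=> x; rewrite in_setI in_set0 inE.
    apply/negP=> /andP[/forall_inP/(_ q qQ) h xA].
    by have := red_clique_redN (rA q qQ) xA; have := cA q qQ; lia.
  have iQ q : (Some q \in None |: (Some @: Q)) = (q \in Q).
    by rewrite !inE mem_imset // => ? ? [].
  move=> [q|] [q'|]; rewrite ?iQ //=.
  + by move=> qQ q'Q nq; apply: dA => //; apply: contraNneq nq => ->.
  + by move=> qQ _ _; rewrite disjoint_sym; apply: dZ.
  + by move=> _ qQ _; apply: dZ.
- move=> [q|]; last by move=> _; apply: bZ.
  rewrite !inE mem_imset /=; last by move=> ? ? [].
  move=> qQ x xA; rewrite (_ : _ :&: _ = set0) ?cards0 //.
  apply/setP=> y; rewrite !inE blueE; apply/negP=> /andP[/andP[nxy nr] yA].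
  by rewrite (cliqueP _ _ (rA q qQ)) in nr.
Qed.

End NoFans.

(** * The bound on the Ramsey number *)

Lemma arrows_fans t n m : 2 < t -> 0 < n ->
  4 * (t * n) <= 2 * m + 4 * n + t * t ->
  20 * (t * cluster_defect t) + 10 * t + 20 * cluster_defect t + 10 < 2 * m ->
  arrows (fan m) (gfan t n) (t * (2 * m + n)).
Proof.
move=> t3 n0 mn large_m; apply/forallP=> c; apply/norP=> -[no_red no_blue].
have bE : blue (color_adj c true) =2 color_adj c false.
  move=> x y; rewrite /blue /color_adj; case: (x != y) => //=.
  by case: (c [set x; y]).
apply: (@fans_unavoidable 'I_(t * (2 * m + n)) (color_adj c true) (color_sym c true)
  (color_irr c true) m n t) => //.
- by move=> x /(@packing_gfan (color_class c true)); apply/negP.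
- move=> x p; case/negP: no_blue; apply: (@packing_gfan (color_class c false) _ _ x).
  apply: (eq_packing bE); apply: packing_sub p.
  by apply/subsetP=> y; rewrite !inE bE.
- by rewrite card_ord.
Qed.

Theorem theorem1p11 (t : nat) (ht : (3 <= t)%N) :
  exists C : rat, forall n m : nat, (0 < n)%N -> (0 < m)%N ->
    (Num.max ((t%:R + 1) * (t%:R + C + 2) + 3)
             ((t%:R - 1) ^+ 2 / (t%:R - 2) * ((n%:R - 1) * (t%:R - 1) + 2))
       <= 2 * m%:R :> rat)%R ->
    (ramsey (fan m) (gfan t n)
       <= maxn m n + (t - 1) * (2 * m + n) + n + m)%N.
Proof.
pose K := 20 * (t * cluster_defect t) + 10 * t + 20 * cluster_defect t + 11.
exists (K%:R)%R => n m n0 m0; rewrite ge_max => /andP[hK hn].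
have {hK} hK : (t + 1) * (t + K + 2) + 3 <= 2 * m.
  by rewrite -(ler_nat rat) natrD natrM 3!natrD natrM.
(* Since (t - 1)^2 >= 4(t - 2), the hypothesis gives 2m >= 4((n - 1)(t - 1) + 2). *)
have {hn} hn : 4 * (t * n) <= 2 * m + 4 * n + t * t.
  case: t ht n n0 hn {K hK} => [|[|[|s]]] // _ [|k] // _.
  have e1 : (s.+3%:R - 1 = s.+2%:R :> rat)%R by rewrite -[s.+3]addn1 natrD addrK.
  have e2 : (s.+3%:R - 2 = s.+1%:R :> rat)%R by rewrite -[s.+3]addn2 natrD addrK.
  have e3 : (k.+1%:R - 1 = k%:R :> rat)%R by rewrite -addn1 natrD addrK.
  rewrite e1 e2 e3 mulrAC ler_pdivrMr ?ltr0n // -natrX -!(natrM, natrD) ler_nat => h.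
  rewrite -(leq_pmul2r (m := s.+1)) //; move: h; nia.
have large_m : 20 * (t * cluster_defect t) + 10 * t + 20 * cluster_defect t + 10 < 2 * m.
  by move: hK; rewrite /K; nia.
(* As t >= 3, [hn] gives 8n <= 2m + t^2, and [hK] gives t^2 < 2m. *)
have le_nm : n <= m by move: hK hn; rewrite /K; nia.
have -> : maxn m n + (t - 1) * (2 * m + n) + n + m = t * (2 * m + n).
  by rewrite (maxn_idPl le_nm); nia.
rewrite /ramsey; case: ex_minnP => r _; apply; exact: arrows_fans.
Qed.
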